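(* Let $c$ and $l\geq 3$ be positive integers and let $\mathbf{c}$ be a $c$-coloring of $\mathbb{N}$ (i.e. a map $\mathbf{c}\colon\mathbb{N}\to[c]=\{1,\dots,c\}$). Then there are $l$-term arithmetic progressions $Q_1,Q_2,Q_3,\dots$ of positive integers such that (i) $Q_1\prec Q_2\prec Q_3\prec\cdots$, and (ii) there is $\gamma\in[c]$ such that for every finite nonempty set $C\subseteq\mathbb{N}$ and every $s\in\{1,\dots,l\}$ we have \[ \mathbf{c}\Big(\bigoplus_{i\in C}Q_i\,[s]\Big)=\gamma . \]
   Context: $\mathbb{N}$ denotes the positive integers. An $l$-term arithmetic progression $P=\{a_1,\dots,a_l\}$ is written with $a_1<\dots<a_l$ (so the common difference is positive), and $P[s]=a_s$ denotes its $s$-th term. For $l$-term arithmetic progressions $P,Q$, the pointwise sum $P\oplus Q$ is the $l$-term arithmetic progression with $(P\oplus Q)[s]=P[s]+Q[s]$ for $1\le s\le l$; for a finite nonempty index set $C$, $\bigoplus_{i\in C}Q_i$ is the pointwise sum of the $Q_i$, $i\in C$, so $\bigoplus_{i\in C}Q_i\,[s]=\sum_{i\in C}Q_i[s]$. We write $P\prec Q$ if $P[s]<Q[s]$ for all $1\le s\le l$. *)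

(* Defs.v *)
From mathcomp Require Import all_boot.
From mathcomp Require Import finmap.

Set Implicit Arguments.
Unset Strict Implicit.
Unset Printing Implicit Defensive.

(* A progression is the function listing its terms in increasing order; terms
   are indexed by 'I_l, i.e. from 0. The terms are positive integers, and the
   common difference d is positive. *)
Definition is_ap (l : nat) (P : 'I_l -> nat) : Prop :=
  exists a d : nat, [/\ 0 < a, 0 < d & forall s : 'I_l, P s = a + s * d].

Definition ap_lt (l : nat) (P Q : 'I_l -> nat) : Prop :=
  forall s : 'I_l, P s < Q s.

Definition ap_sum (l : nat) (C : {fset nat}) (Q : nat -> 'I_l -> nat) :
    'I_l -> nat :=
  fun s => \sum_(i <- C) Q i s.

Lemma is_ap_sum (l : nat) (C : {fset nat}) (Q : nat -> 'I_l -> nat) :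
  C != fset0 -> (forall i, i \in C -> is_ap (Q i)) -> is_ap (ap_sum C Q).
Proof.
move=> /fset0Pn[i0 i0C] apQ; rewrite /ap_sum.
have {i0C}: i0 \in (C : seq nat) by [].
have {apQ}: forall i, i \in (C : seq nat) -> is_ap (Q i) by [].
elim: (C : seq nat) i0 => // i [|j r] IHr _ apQ _.
  have [a [d [a0 d0 aP]]] := apQ i (mem_head _ _).
  by exists a, d; split=> // s; rewrite big_seq1.
have [a [d [a0 d0 aP]]] := apQ i (mem_head _ _).
have apQr k : k \in j :: r -> is_ap (Q k).
  by move=> kr; apply: apQ; rewrite in_cons kr orbT.
have [a' [d' [a'0 d'0 aP']]] := IHr j apQr (mem_head _ _).
exists (a + a'), (d + d'); split; rewrite ?addn_gt0 ?a0 ?d0 // => s.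
by rewrite big_cons aP aP' mulnDr addnACA.
Qed.

(* Main.v *)
(* The sets containing arbitrarily long progressions are partition regular by
   van der Waerden, and translates of a set without this property lack it too;
   hence all members of some idempotent ultrafilter F on (nat, +) have it. One
   colour class is in F, and the Galvin-Glazer proof of Hindman's theorem
   applies with one change: at each step the set in F supplies a whole l-term
   progression instead of a single element. *)

Require Import Defs.
From mathcomp Require Import all_boot.
From mathcomp Require Import finmap.
From mathcomp Require Import zify.
From mathcomp Require Import boolp classical_sets filter.

Set Implicit Arguments.
Unset Strict Implicit.
Unset Printing Implicit Defensive.

Local Open Scope classical_set_scope.

(** * Van der Waerden's theorem *)

Definition mono_ap (T : Type) (c : nat -> T) (k a d : nat) : Prop :=
  0 < d /\ forall i, i < k -> c (a + i * d) = c a.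

(* Colour focusing; an entry (a, d) of s encodes a first term and a difference. *)
Definition focused (T : eqType) (c : nat -> T) (k f : nat)
    (s : seq (nat * nat)) : Prop :=
  (forall p, p \in s -> mono_ap c k p.1 p.2 /\ p.1 + k * p.2 = f)
  /\ uniq [seq c p.1 | p <- s].

(** The bound covers [a + k * d], the point just after the last term, where a focus lies. *)
Definition vdW (k : nat) : Prop :=
  forall T : finType, exists N, forall c : nat -> T,
    exists a d, mono_ap c k a d /\ a + k * d <= N.

(* The window colouring x |-> c restricted to [x, x + n] has a monochromatic
   progression; translating a focused family along it, and adding the
   progression of its foci, yields one more colour. *)
Lemma vdW_focus (k : nat) (T : finType) (r : nat) : vdW k.+1 ->
  exists N, forall c : nat -> T,
    (exists a d, mono_ap c k.+2 a d /\ a + k.+1 * d <= N) \/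
    (exists f s, [/\ focused c k.+1 f s, size s = r & f <= N]).
Proof.
move=> vk; elim: r => [|r [n IHr]].
  by exists 0 => c; right; exists 0, [::]; split=> //; split.
have [M HM] := vk {ffun 'I_n.+1 -> T}.
exists (M + n) => c.
have [x [D [[D0 monoD] xM]]] := HM (fun x => [ffun i : 'I_n.+1 => c (x + i)]).
have win i j : i < k.+1 -> j <= n -> c (x + i * D + j) = c (x + j).
  move=> ik jn; pose j' : 'I_n.+1 := Ordinal (jn : j < n.+1).
  have := congr1 (fun g : {ffun 'I_n.+1 -> T} => g j') (monoD i ik).
  by rewrite !ffunE.
have [[a [d [[d0 monoa] an]]]|[f [s [[sP sU] ss fn]]]] :=
  IHr (fun y => c (x + y)).
  left; exists (x + a), d; split; last by nia.
  by split=> // i ik; rewrite -addnA monoa.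
have fP p : p \in s -> p.1 <= n by move=> /sP[_]; nia.
have tP a d : mono_ap (fun y => c (x + y)) k.+1 a d -> a + k.+1 * d = f ->
    mono_ap c k.+1 (x + a) (D + d) /\ x + a + k.+1 * (D + d) = x + f + k.+1 * D.
  move=> [d0 ma] af; split; last by nia.
  split=> [|i ik]; first by lia.
  have -> : x + a + i * (D + d) = x + i * D + (a + i * d) by nia.
  by rewrite win ?ma //; nia.
(* If the focus [x + f] repeats the colour of a member, appending it to that member gives [k.+2]
   terms; otherwise it supplies the new colour. *)
have [/mapP[p ps cp]|fU] := boolP (c (x + f) \in [seq c (x + p.1) | p <- s]).
  left; have [[d0 ma] af] := sP p ps.
  exists (x + p.1), p.2; split; last by nia.
  split=> // i; rewrite ltnS leq_eqVlt => /orP[/eqP->|ik].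
    by rewrite -addnA af.
  by rewrite -addnA ma.
right; exists (x + f + k.+1 * D).
exists ((x + f, D) :: [seq (x + p.1, D + p.2) | p <- s]).
split; last by nia.
- split=> [p|].
    rewrite in_cons => /orP[/eqP-> /=|/mapP[q qs ->] /=].
      split=> //; split=> // i ik.
      by rewrite addnAC win.
    by have [ma af] := sP q qs; apply: tP.
  by rewrite /= -map_comp fU.
- by rewrite /= size_map ss.
Qed.

Lemma van_der_Waerden (k : nat) : vdW k.
Proof.
case: k => [|k]; first by move=> T; exists 0 => c; exists 0, 1.
elim: k => [|k IHk] T.
  exists 1 => c; exists 0, 1; split=> //; split=> // i.
  by rewrite ltnS leqn0 => /eqP->.
have [N HN] := vdW_focus T #|T|.+1 IHk.
(* The first alternative bounds only the terms; the point after them costs one more [d <= N]. The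
   second contradicts the pigeonhole principle. *)
exists (N + N) => c; have [[a [d [ma aN]]]|[f [s [[_ sU] ss _]]]] := HN c.
  by exists a, d; split=> //; nia.
have := max_card (mem [seq c p.1 | p <- s]).
by rewrite (card_uniqP sU) size_map ss ltnn.
Qed.

(** * Sets containing arbitrarily long progressions *)

Definition ap_rich (A : set nat) : Prop :=
  forall k, exists a d, 0 < d /\ forall i, i < k -> A (a + i * d).

Lemma ap_rich_sub (A B : set nat) : A `<=` B -> ap_rich A -> ap_rich B.
Proof.
move=> AB rA k; have [a [d [d0 ma]]] := rA k.
by exists a, d; split=> // i /ma/AB.
Qed.

Lemma ap_rich_shift (A : set nat) (x : nat) :
  ap_rich [set y | A (x + y)] -> ap_rich A.
Proof.
move=> rA k; have [a [d [d0 ma]]] := rA k.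
by exists (x + a), d; split=> // i /ma; rewrite -addnA.
Qed.

Lemma ap_rich_gt (A : set nat) (m k : nat) : ap_rich A ->
  exists a d, [/\ m < a, 0 < d & forall i, i < k -> A (a + i * d)].
Proof.
move=> rA; have [a [d [d0 ma]]] := rA (m.+1 + k).
(* Skipping [m.+1] terms pushes the start beyond [m]. *)
exists (a + m.+1 * d), d; split=> // [|i ik]; first by nia.
by rewrite -addnA -mulnDl; apply: ma; lia.
Qed.

Lemma ap_richU (A B : set nat) :
  ap_rich (A `|` B) -> ap_rich A \/ ap_rich B.
Proof.
move=> rAB; apply: contrapT => /not_orP[/existsNP[k1 nA] /existsNP[k2 nB]].
have [N HN] := van_der_Waerden (maxn k1 k2) bool.
have [a [d [d0 abd]]] := rAB N.+1.
(* The indices of the long progression are two-coloured by membership in [A]. *)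
have [b [e [[e0 me] be]]] := HN (fun i => `[< A (a + i * d) >]).
have [k0|kpos] := posnP (maxn k1 k2).
  by apply: nA; exists 0, 1; split=> // i; lia.
have eqi i : a + b * d + i * (e * d) = a + (b + i * e) * d by nia.
have [/asboolP Ab|/asboolP nAb] := boolP `[< A (a + b * d) >].
  apply: nA; exists (a + b * d), (e * d); split=> [|i ik]; first by nia.
  by rewrite eqi; apply/asboolP; rewrite me ?leq_max ?ik //; apply/asboolP.
apply: nB; exists (a + b * d), (e * d); split=> [|i ik]; first by nia.
have ik' : i < maxn k1 k2 by lia.
rewrite eqi; have [|//] : (A `|` B) (a + (b + i * e) * d) by apply: abd; nia.
by move=> /asboolP; rewrite me // => /asboolP.
Qed.

(** * Idempotent ultrafilters on a semigroup *)

Section filter_product.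
Variables (T : Type) (op : T -> T -> T).
Hypothesis opA : associative op.

Definition shift (x : T) (A : set T) : set T := [set y | A (op x y)].

(** On ultrafilters this is the extension of [op] to the Stone-Cech compactification. *)
Definition filter_op (F G : set_system T) : set_system T :=
  [set A | F [set x | G (shift x A)]].

Lemma shift_op x y A : shift (op x y) A = shift y (shift x A).
Proof. by apply/predeqP => z; rewrite /shift /= opA. Qed.

Lemma filter_op_filter (F G : set_system T) :
  Filter F -> Filter G -> Filter (filter_op F G).
Proof.
move=> FF GF; constructor.
- by rewrite /filter_op /=; apply: filterS filterT => x _; exact: filterT.
- move=> A B; rewrite /filter_op /= => FA FB.
  by apply: filterS (filterI FA FB) => x []; exact: filterI.
- move=> A B AB; rewrite /filter_op /=; apply: filterS => x.
  by apply: filterS => y; exact: AB.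
Qed.

Lemma filter_op_proper (F G : set_system T) :
  ProperFilter F -> ProperFilter G -> ProperFilter (filter_op F G).
Proof.
move=> FF GF; apply: Build_ProperFilter_ex (filter_op_filter _ _) => A.
rewrite /filter_op /= => FA.
by have [x Gx] := filter_ex FA; have [y Ay] := filter_ex Gx; exists (op x y).
Qed.

Lemma filter_op_mono (F F' G G' : set_system T) : Filter F ->
  F `<=` F' -> G `<=` G' -> filter_op F G `<=` filter_op F' G'.
Proof.
move=> FF FF' GG' A FA; apply: FF'; rewrite /filter_op /= in FA.
by apply: filterS FA => x; exact: GG'.
Qed.

(* Such a filter is the algebraic counterpart of a closed subsemigroup of the
   Stone-Cech compactification, with the inclusion order reversed. *)
Definition semigroup_filter (F : set_system T) : Prop :=
  ProperFilter F /\ F `<=` filter_op F F.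

Lemma maximal_semigroup_filter (F0 : set_system T) : semigroup_filter F0 ->
  exists F, [/\ semigroup_filter F, F0 `<=` F &
    forall G, semigroup_filter G -> F `<=` G -> G `<=` F].
Proof.
move=> sF0.
pose P (F : set_system T) := F = set0 \/ semigroup_filter F /\ F0 `<=` F.
have [] := @Zorn_bigcup _ P.
  move=> C CP totC.
  have [[F1 CF1 F1n]|allE] := pselect (exists2 F, C F & F <> set0); last first.
    left; rewrite -subset0 => A [F CF FA].
    by apply: allE; exists F => // F0E; rewrite F0E in FA.
  right; have [//|[[F1F _] F01]] := CP _ CF1.
  have CS F A : C F -> F A -> semigroup_filter F.
    by move=> CF FA; have [F0E|[]//] := CP _ CF; rewrite F0E in FA.
  split; last by move=> A /F01; exists F1.
  split.
    apply: Build_ProperFilter.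
      move=> [F CF Fe]; have [FF _] := CS _ _ CF Fe.
      exact: filter_not_empty Fe.
    constructor.
    - by exists F1 => //; apply: filterT.
    - move=> A B [F CF FA] [G CG GB].
      have [[FF _] [GF _]] := (CS _ _ CF FA, CS _ _ CG GB).
      have [FG|GF'] := totC _ _ CF CG.
        by exists G => //; apply: filterI => //; apply: FG.
      by exists F => //; apply: filterI => //; apply: GF'.
    - move=> A B AB [F CF FA]; have [FF _] := CS _ _ CF FA.
      by exists F => //; apply: filterS FA.
  move=> A [F CF FA]; have [FF sF] := CS _ _ CF FA.
  by apply: filter_op_mono (sF _ FA) => B FB; exists F.
move=> F [PF maxF].
have maxF' G : semigroup_filter G -> F0 `<=` G -> F `<=` G -> G `<=` F.
  move=> sG F0G FG; apply: contrapT => nGF.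
  by apply: (maxF G); [split | right].
have [FE|[sF F0F]] := PF.
  have F0T : F0 setT by have [F0p _] := sF0; exact: filterT.
  by have : F setT; [apply: (maxF' F0) => //; rewrite FE | rewrite FE].
by exists F; split=> // G sG FG; apply: maxF' => //; apply: subset_trans FG.
Qed.

(** If [F] describes the closed subsemigroup S and [G] is an ultrafilter q in S, the product
    describes Sq, which lies in S and is closed under [op] since SqS lies in S. *)
Lemma filter_op_semigroup (F G : set_system T) : semigroup_filter F ->
  ProperFilter G -> F `<=` G ->
  semigroup_filter (filter_op F G) /\ F `<=` filter_op F G.
Proof.
move=> [FF sF] GF FG.
have FFG : F `<=` filter_op F G.
  by apply: subset_trans sF _; apply: filter_op_mono.
split=> //; split; first exact: filter_op_proper.
move=> A /sF; rewrite /filter_op /= => FA; apply: FFG; apply: filterS FA => x.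
rewrite /shift /=.
by apply: filterS => y /=; under eq_fun do rewrite -opA.
Qed.

(* The Ellis-Numakura argument: for an ultrafilter q above a maximal F,
   maximality gives F + q = F, and then that q belongs to the closed
   subsemigroup {x | x + q = q}, so that q lies below F. *)
Lemma maximal_semigroup_filter_ultra (F : set_system T) : semigroup_filter F ->
  (forall G, semigroup_filter G -> F `<=` G -> G `<=` F) -> UltraFilter F.
Proof.
move=> sF maxF; have [FF FsF] := sF.
have [q [qU Fq]] := ultraFilterLemma FF.
have FqF : filter_op F q `<=` F.
  by have [sG FG] := filter_op_semigroup sF _ Fq; apply: maxF.
pose B (A : set T) := [set x | q (shift x A)].
(* An ultrafilter p contains all [B A] with [q A] exactly when p + q = q, so [H] describes the
   solutions p above [F]. *)
pose H : set_system T :=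
  [set X | exists Y A, [/\ F Y, q A & Y `&` B A `<=` X]].
have FH : F `<=` H.
  by move=> Y FY; exists Y, setT; split=> [//||x []//]; apply: filterT.
have BH A : q A -> H (B A).
  by move=> qA; exists setT, A; split=> [|//|x []//]; apply: filterT.
have HF : ProperFilter H.
  apply: Build_ProperFilter.
    (* Solvability of p + q = q: if [Y] missed [B A], the complement of [A] would lie in F + q,
       hence in [F] and in [q]. *)
    move=> [Y [A [FY qA YB]]]; apply: (filter_not_empty q).
    rewrite -(setICr A); apply: filterI => //; apply: Fq; apply: FqF.
    rewrite /filter_op /=; apply: filterS FY => x Yx.
    have [qxA|//] := in_ultra_setVsetC (shift x A) qU.
    by case: (YB x).
  constructor.
  - by exists setT, setT; split=> //; apply: filterT.
  - move=> X X' [Y [A [FY qA YX]]] [Y' [A' [FY' qA' YX']]].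
    exists (Y `&` Y'), (A `&` A'); split; [exact: filterI|exact: filterI|].
    move=> x [[Yx Y'x] Bx]; split; [apply: YX|apply: YX']; split=> //;
      by apply: filterS Bx => y [].
  - move=> X X' XX' [Y [A [FY qA YX]]].
    by exists Y, A; split=> //; apply: subset_trans XX'.
have sH : H `<=` filter_op H H.
  move=> X [Y [A [FY qA YX]]].
  have HHF := filter_op_filter HF HF.
  apply: (filterS YX); apply: filterI.
    by apply: filter_op_mono (FsF _ FY).
  rewrite /filter_op /=; apply: filterS (BH A qA) => x /BH; apply: filterS => y.
  by rewrite /B /shift /=; under [in X in _ -> X]eq_fun do rewrite -opA.
have HsF : H `<=` F by apply: maxF.
suff <- : q = F by [].
(* [F (B A)] is by definition [filter_op F q A]. *)
apply/seteqP; split=> // A /BH/HsF FA; exact: FqF.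
Qed.

(** For an ultrafilter the last inclusion is an equality, by maximality among proper filters. *)
Lemma idempotent_ultrafilter (F0 : set_system T) : semigroup_filter F0 ->
  exists F, [/\ UltraFilter F, F0 `<=` F & F `<=` filter_op F F].
Proof.
move=> /maximal_semigroup_filter[F [sF F0F maxF]].
by exists F; split=> //; [apply: maximal_semigroup_filter_ultra | case: sF].
Qed.

(* B is the usual A* = {x in A | A - x in F}. *)
Lemma idempotent_star (F : set_system T) (A : set T) : Filter F ->
  F `<=` filter_op F F -> F A ->
  exists B, [/\ B `<=` A, F B & forall x, B x -> F (shift x B)].
Proof.
move=> FF sF FA; exists (A `&` [set x | F (shift x A)]); split.
- by move=> x [].
- by apply: filterI => //; apply: sF.
- move=> x [_ Fx]; apply: filterS (filterI Fx (sF _ Fx)) => y [Ay Fy].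
  by split=> //; rewrite /= shift_op.
Qed.

End filter_product.


Lemma ap_rich_semigroup_filter :
  semigroup_filter addn [set A | ~ ap_rich (~` A)].
Proof.
split.
  apply: Build_ProperFilter => /=.
    by rewrite setC0; apply=> k; exists 0, 1; split.
  constructor=> [|A B nA nB|A B AB] /=.
  - by rewrite setCT => /(_ 1)[a [d [_ /(_ 0 isT)]]].
  - by rewrite setCI => /ap_richU[].
  - by apply: contra_not; apply: ap_rich_sub; apply: subsetC.
move=> A /= nA /(_ 1)[x [d [_ /(_ 0 isT)]]]; apply=> /= rA.
by apply: nA; apply: ap_rich_shift rA.
Qed.

Lemma ultra_colour (T : Type) (F : set_system T) (col : T -> nat) (c : nat) :
  UltraFilter F -> F [set x | 1 <= col x <= c] ->
  exists g, 1 <= g <= c /\ F [set x | col x = g].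
Proof.
move=> FU; elim: c => [|c IHc] Fc.
  by have [x] := filter_ex Fc => /=; lia.
have [Fg|Fg] := in_ultra_setVsetC [set x | col x = c.+1] FU.
  by exists c.+1; rewrite leqnn.
have [|g [gc Fgg]] := IHc.
  by apply: filterS (filterI Fc Fg) => x [] /=; lia.
by exists g; split=> //; lia.
Qed.

(** * The Galvin-Glazer construction with progressions *)

Section ap_sequence.
Variables (l : nat) (F : set_system nat).
Hypotheses (FF : Filter F) (idemF : F `<=` filter_op addn F F).
Hypothesis richF : forall A, F A -> ap_rich A.

Definition star_set (B : set nat) : Prop :=
  F B /\ forall x, B x -> F (shift addn x B).

Lemma star_set_step (B : set nat) (m : nat) : star_set B ->
  exists (Q : 'I_l -> nat) (B' : set nat) (m' : nat),
    star_set B' /\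
    [/\ is_ap Q, forall s, m < Q s <= m',
        forall s, B (Q s), B' `<=` B &
        forall s, B' `<=` shift addn (Q s) B].
Proof.
move=> [FB sB]; have [a [d [am d0 Bad]]] := ap_rich_gt m l (richF FB).
pose Q (s : 'I_l) := a + s * d.
have BQ s : B (Q s) by apply: Bad.
(* The new set is in [F] because only finitely many [s] occur. No term exceeds [a + l * d], so a
   next progression started above it dominates termwise. *)
exists Q, (B `&` [set x | forall s, B (Q s + x)]), (a + l * d).
split; last split=> //.
- have Fcap A : (forall s, F (shift addn (Q s) A)) ->
      F [set x | forall s, A (Q s + x)].
    by move=> FA; apply: filter_forall.
  split=> [|x [Bx Bsx]].
    by apply: filterI => //; apply: Fcap => s; apply: sB.
  have FBx : F [set y | forall s, shift addn x B (Q s + y)].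
    apply: Fcap => s; apply: filterS (sB _ (Bsx s)) => y.
    by rewrite /shift /= addnA (addnC x).
  apply: filterS (filterI (sB x Bx) FBx) => y [Bxy Bsy].
  by split=> // s; rewrite addnCA; apply: Bsy.
- by exists a, d; split=> //; lia.
- by move=> s; rewrite /Q; have := ltn_ord s; nia.
- by move=> s x [_ /(_ s)].
Qed.

Lemma ap_sequence (A : set nat) : F A -> exists Q : nat -> 'I_l -> nat,
  [/\ forall i, is_ap (Q i), forall i, ap_lt (Q i) (Q i.+1) &
      forall C : {fset nat}, C != fset0 -> forall s, A (ap_sum C Q s)].
Proof.
move=> FA; have [B0 [B0A FB0 sB0]] := idempotent_star addnA FF idemF FA.
pose state := {p : set nat * nat | star_set p.1}.
have /choice[f fP] (st : state) : exists u : ('I_l -> nat) * state,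
    let B := (sval st).1 in let B' := (sval u.2).1 in
    [/\ is_ap u.1, forall s, (sval st).2 < u.1 s <= (sval u.2).2,
        forall s, B (u.1 s), B' `<=` B &
        forall s, B' `<=` shift addn (u.1 s) B].
  case: st => -[B m] /= sB.
  have [Q [B' [m' [sB' QP]]]] := star_set_step m sB.
  by exists (Q, exist _ (B', m') sB').
pose st n : state := iter n (fun p => (f p).2) (exist _ (B0, 0) (conj FB0 sB0)).
pose Q n := (f (st n)).1; pose B n := (sval (st n)).1.
have BQ n s : B n (Q n s) by have [_ _ + _ _] := fP (st n); exact.
have BS n : B n.+1 `<=` B n by have [_ _ _ + _] := fP (st n).
have BD n s x : B n.+1 x -> B n (Q n s + x).
  by have [_ _ _ _ +] := fP (st n); apply.
have Ble m n : m <= n -> B n `<=` B m.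
  move=> /subnK<-; elim: (n - m) => // k IHk; exact: subset_trans (BS _) IHk.
exists Q; split.
- by move=> i; have [] := fP (st i).
- move=> i s; have [_ /(_ s)/andP[_ Qi] _ _ _] := fP (st i).
  by have [_ /(_ s)/andP[+ _] _ _ _] := fP (st i.+1); apply: leq_ltn_trans.
- move=> C C0 s; apply: B0A.
  (* With indices sorted, the sum over those after [n] lies in some [B m] with [n < m], hence in
     [B n.+1], so adding [Q n s] lands in [B n]. *)
  rewrite /ap_sum -(perm_big _ (permEl (perm_sort leq C))) /=.
  have : sort leq C != [::] by rewrite -size_eq0 size_sort -lt0n cardfs_gt0.
  have : sorted ltn (sort leq C).
    rewrite ltn_sorted_uniq_leq sort_uniq fset_uniq.
    by rewrite sort_sorted //; exact: leq_total.
  case: (sort leq C) => // n r + _ /=; rewrite -/(B 0).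
  move=> pr; apply: (Ble 0 n) => //; elim: r n pr => [|m r IHr] n /=.
    by rewrite big_seq1 => _; apply: BQ.
  move=> /andP[nm pr]; rewrite big_cons.
  by apply: BD; apply: Ble nm _ (IHr _ pr).
Qed.

End ap_sequence.

Theorem theorem3p1 (c l : nat) (c_gt0 : 0 < c) (l_ge3 : 3 <= l)
    (col : nat -> nat) (col_range : forall n : nat, 0 < n -> 1 <= col n <= c) :
  exists Q : nat -> 'I_l -> nat,
    [/\ forall i : nat, is_ap (Q i),
        forall i : nat, ap_lt (Q i) (Q i.+1)
      & exists gamma : nat, 1 <= gamma <= c /\
          forall C : {fset nat}, C != fset0 ->
            forall s : 'I_l, col (ap_sum C Q s) = gamma].
Proof.
have [F [FU F0F idemF]] := idempotent_ultrafilter addnA ap_rich_semigroup_filter.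
have richF A : F A -> ap_rich A.
  move=> FA; apply: contrapT => nA; have /filter_ex[x [//]] : F (A `&` ~` A).
  by apply: filterI => //; apply: F0F => /=; rewrite setCK.
(* The colour of 0 is unconstrained, but a set without positive elements is not rich. *)
have Fpos : F [set n | 1 <= col n <= c].
  apply: F0F => /= /(ap_rich_gt 0 1)[a [d [a0 _ /(_ 0 isT)]]].
  by rewrite mul0n addn0; apply; apply: col_range.
have [g [gc Fg]] := ultra_colour FU Fpos.
have [Q [apQ ltQ colQ]] := ap_sequence l _ idemF richF Fg.
by exists Q; split=> //; exists g.
Qed.
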